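(* Let $R$ be the cosemigroup in the variety $\mathbf{Sgp}$ of semigroups whose underlying semigroup is $$|R|=\langle x_{00},x_{11},p_i,q_i\ (i\in\omega)\mid x_{00}^2=x_{00},\ x_{11}^2=x_{11},\ x_{00}p_i=p_i=p_ix_{11},\ x_{11}q_i=q_i=q_ix_{00}\rangle$$ and whose co-operation $\beta^R:|R|\to|R|\amalg|R|$ is the homomorphism determined by $$\beta^R(x_{00})=x_{00}^{(0)},\quad\beta^R(x_{11})=x_{11}^{(1)},\quad \beta^R(p_i)=p_i^{(0)}\big(x_{00}^{(1)}x_{11}^{(0)}\big)^i p_i^{(1)},\quad \beta^R(q_i)=q_i^{(1)}\big(x_{11}^{(0)}x_{00}^{(1)}\big)^i q_i^{(0)},$$ where $u^{(0)},u^{(1)}$ denote the images of $u\in|R|$ under the first and second coprojections $|R|\to|R|\amalg|R|$ (coproduct in semigroups) and a zeroth power means the factor is omitted. Then $R$ is a cosemigroup (i.e. $\beta^R$ is coassociative) and is the final object of $\mathrm{Coalg}(\mathbf{Sgp},\mathbf{Sgp})$. Equivalently, the initial representable functor $E:\mathbf{Sgp}\to\mathbf{Sgp}$ sends a semigroup $A$ to the set of tuples $(a;b;c_0,c_1,\dots;d_0,d_1,\dots)\in|A|^{1+1+\omega+\omega}$ with $a^2=a$, $b^2=b$, $ac_i=c_i=c_ib$, $bd_i=d_i=d_ia$ for all $i$, under the multiplication $(a;b;\dots,c_i,\dots;\dots,d_i,\dots)(a';b';\dots,c'_i,\dots;\dots,d'_i,\dots)=(a;b';\dots,c_i(a'b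)^ic'_i,\dots;\dots,d'_i(ba')^id_i,\dots)$.
   Context: $\mathbf{Sgp}$ is the variety of semigroups (associative binary operation, no identity element). A cosemigroup in $\mathbf{Sgp}$ is a semigroup $|S|$ with a homomorphism $\beta^S:|S|\to|S|\amalg|S|$ into the coproduct (free product) of two copies of itself such that for every semigroup $A$ the set $\mathrm{Hom}(|S|,A)$, with the multiplication $(g\cdot h)=(g\vee h)\circ\beta^S$ (where $g\vee h:|S|\amalg|S|\to A$ restricts to $g$ and $h$ on the two copies), is a semigroup. $\mathrm{Coalg}(\mathbf{Sgp},\mathbf{Sgp})$ is the category of cosemigroups in $\mathbf{Sgp}$ with morphisms the homomorphisms $f$ satisfying $(f\amalg f)\circ\beta^S=\beta^{S'}\circ f$; it is equivalent to the opposite of the category of representable functors $\mathbf{Sgp}\to\mathbf{Sgp}$, $S\mapsto\mathrm{Hom}(|S|,-)$. *)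

(* Defs.v *)
From Stdlib Require Import PeanoNat.

Record sgp := Sgp {
  car :> Type;
  op : car -> car -> car;
  op_assoc : forall x y z, op (op x y) z = op x (op y z)
}.
Arguments op {s} _ _.

Record hom (A B : sgp) := Hom {
  fn :> A -> B;
  fn_op : forall x y, fn (op x y) = op (fn x) (fn y)
}.
Arguments fn {A B} _ _.

Definition heq {A B : sgp} (f g : hom A B) : Prop := forall x, f x = g x.

Definition comp {A B C : sgp} (g : hom B C) (f : hom A B) : hom A C.
Proof.
  refine (@Hom A C (fun x => g (f x)) _).
  intros x y; rewrite (fn_op _ _ f), (fn_op _ _ g); reflexivity.
Defined.

Record Coprod (S : sgp) := {
  cp_obj : sgp;
  cp_in0 : hom S cp_obj;
  cp_in1 : hom S cp_obj;
  cp_pair : forall A : sgp, hom S A -> hom S A -> hom cp_obj A;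
  cp_pair0 : forall A g h, heq (comp (cp_pair A g h) cp_in0) g;
  cp_pair1 : forall A g h, heq (comp (cp_pair A g h) cp_in1) h;
  cp_uniq : forall A g h (k : hom cp_obj A),
      heq (comp k cp_in0) g -> heq (comp k cp_in1) h -> heq k (cp_pair A g h)
}.
Arguments cp_obj {S} _.
Arguments cp_in0 {S} _.
Arguments cp_in1 {S} _.
Arguments cp_pair {S} _ {A} _ _.

Definition comul {S : sgp} (C : Coprod S) (beta : hom S (cp_obj C))
  {A : sgp} (g h : hom S A) : hom S A :=
  comp (cp_pair C g h) beta.

(** β makes S a cosemigroup: every Hom(|S|, A) is a semigroup under comul. *)
Definition coassoc {S : sgp} (C : Coprod S) (beta : hom S (cp_obj C)) : Prop :=
  forall (A : sgp) (g h k : hom S A),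
    heq (comul C beta (comul C beta g h) k) (comul C beta g (comul C beta h k)).

Record Cosgp := {
  cs_car : sgp;
  cs_cp : Coprod cs_car;
  cs_beta : hom cs_car (cp_obj cs_cp);
  cs_coassoc : coassoc cs_cp cs_beta
}.

Definition coprod_map {S T : sgp} (CS : Coprod S) (CT : Coprod T) (f : hom S T)
  : hom (cp_obj CS) (cp_obj CT) :=
  cp_pair CS (comp (cp_in0 CT) f) (comp (cp_in1 CT) f).

Definition is_comor {S T : sgp} (CS : Coprod S) (betaS : hom S (cp_obj CS))
  (CT : Coprod T) (betaT : hom T (cp_obj CT)) (f : hom S T) : Prop :=
  heq (comp (coprod_map CS CT f) betaS) (comp betaT f).

Definition R_rels (A : sgp) (a b : A) (c d : nat -> A) : Prop :=
  op a a = a /\ op b b = b /\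
  (forall i, op a (c i) = c i /\ op (c i) b = c i) /\
  (forall i, op b (d i) = d i /\ op (d i) a = d i).

Definition is_R_presentation (R : sgp) (x00 x11 : R) (p q : nat -> R) : Prop :=
  R_rels R x00 x11 p q /\
  forall (A : sgp) (a b : A) (c d : nat -> A),
    R_rels A a b c d ->
    exists f : hom R A,
      (f x00 = a /\ f x11 = b /\ (forall i, f (p i) = c i) /\ (forall i, f (q i) = d i)) /\
      forall g : hom R A,
        g x00 = a -> g x11 = b -> (forall i, g (p i) = c i) -> (forall i, g (q i) = d i) ->
        heq g f.

(** u w^n  (n = 0 means the factor w^n is omitted). *)
Definition rpow {A : sgp} (u w : A) (n : nat) : A :=
  Nat.iter n (fun y => op y w) u.

(* Main.v *)
(** Let [W] be the semigroup generated by idempotent letters [0, 1, 2, ...]: its elements are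
    words without repeated adjacent letters.  For a cosemigroup [S] the constant maps
    [c_i : S -> W] onto the letters are homomorphisms, and [c_i c_i = c_i] in [Hom(S, W)].
    By coassociativity the words [w_n(s) = (c_0 c_1 ... c_n)(s)] are compatible with all monotone
    surjections [{0..n} -> {0..m}].  Comparing the three collapses of [w_3(s)] to [w_2(s)] forces
    [w_2(s)] to be a concatenation of jumps [0 2], [2 0] and of the blocks
    [0 (1 0)^i 1 (2 1)^i 2] and [2 (1 2)^i 1 (0 1)^i 0], which are the values of [w_2] at
    [x00 x11], [x11 x00], [p_i] and [q_i].  As [w_2] is injective on [R], there is a unique
    map [f : S -> R] preserving [w_2], and it is a homomorphism; every morphism of
    cosemigroups preserves [w_2], whence uniqueness.
    Finally [w_2] determines [w_5], because a word over [{0..5}] is determined by its collapses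
    to three letters, and [w_5 = w_2 * (w_2 shifted by 3)] is the image of the co-operation under
    a map [R + R -> W] that is injective by the normal form in a coproduct; so [f] is a morphism
    of cosemigroups. *)

From Stdlib Require Import PeanoNat Lia List Bool ProofIrrelevance IndefiniteDescription.
Require Import Defs.
Import ListNotations.

(** * Subsemigroups, coproducts and comultiplication *)

Definition cid (A : sgp) : hom A A := Hom A A (fun x => x) (fun x y => eq_refl).

Section Subsemigroup.
Context (A : sgp) (P : A -> Prop) (HP : forall x y, P x -> P y -> P (op x y)).

Definition sub_op (u v : {x : A | P x}) : {x : A | P x} :=
  exist P (op (proj1_sig u) (proj1_sig v)) (HP _ _ (proj2_sig u) (proj2_sig v)).

Lemma sub_op_assoc u v w : sub_op (sub_op u v) w = sub_op u (sub_op v w).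
Proof. apply subset_eq_compat, op_assoc. Qed.

Definition sub_sgp : sgp := Sgp {x : A | P x} sub_op sub_op_assoc.

Definition sub_incl : hom sub_sgp A :=
  Hom sub_sgp A (@proj1_sig A P) (fun x y => eq_refl).

Definition sub_corestr (S : sgp) (f : hom S A) (Hf : forall s, P (f s)) : hom S sub_sgp.
Proof.
  refine (Hom S sub_sgp (fun s => exist P (f s) (Hf s)) _).
  intros x y; apply subset_eq_compat, fn_op.
Defined.
End Subsemigroup.

Lemma pair_in0 (S : sgp) (C : Coprod S) (A : sgp) (g h : hom S A) x :
  cp_pair C g h (cp_in0 C x) = g x.
Proof. exact (cp_pair0 S C A g h x). Qed.

Lemma pair_in1 (S : sgp) (C : Coprod S) (A : sgp) (g h : hom S A) x :
  cp_pair C g h (cp_in1 C x) = h x.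
Proof. exact (cp_pair1 S C A g h x). Qed.

Lemma coprod_hom_ext (S : sgp) (C : Coprod S) (A : sgp) (k k' : hom (cp_obj C) A) :
  (forall x, k (cp_in0 C x) = k' (cp_in0 C x)) ->
  (forall x, k (cp_in1 C x) = k' (cp_in1 C x)) -> heq k k'.
Proof.
  intros H0 H1 u.
  rewrite (cp_uniq S C A (comp k' (cp_in0 C)) (comp k' (cp_in1 C)) k H0 H1 u).
  symmetry; apply cp_uniq; intros x; reflexivity.
Qed.

(** Corestrict both coprojections to the subsemigroup [P]; the induced map followed by the inclusion
    is the identity, by uniqueness. *)
Lemma coprod_ind (S : sgp) (C : Coprod S) (P : cp_obj C -> Prop) :
  (forall x y, P x -> P y -> P (op x y)) ->
  (forall s, P (cp_in0 C s)) -> (forall s, P (cp_in1 C s)) -> forall u, P u.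
Proof.
  intros HP H0 H1 u.
  pose (k := cp_pair C (sub_corestr _ P HP S (cp_in0 C) H0) (sub_corestr _ P HP S (cp_in1 C) H1)).
  assert (E : heq (comp (sub_incl _ P HP) k) (cid (cp_obj C))).
  { apply coprod_hom_ext; intros s; unfold k; cbn [comp fn sub_incl cid].
    - now rewrite pair_in0.
    - now rewrite pair_in1. }
  specialize (E u); simpl in E; rewrite <- E; apply proj2_sig.
Qed.

Lemma comul_ext (S : sgp) (C : Coprod S) (beta : hom S (cp_obj C)) (A : sgp)
  (g g' h h' : hom S A) :
  heq g g' -> heq h h' -> heq (comul C beta g h) (comul C beta g' h').
Proof.
  intros Hg Hh s; apply coprod_hom_ext; intros x.
  - rewrite !pair_in0; apply Hg.
  - rewrite !pair_in1; apply Hh.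
Qed.

Lemma comp_comul (S : sgp) (C : Coprod S) (beta : hom S (cp_obj C)) (A B : sgp)
  (k : hom A B) (g h : hom S A) :
  heq (comp k (comul C beta g h)) (comul C beta (comp k g) (comp k h)).
Proof.
  intros s; apply (coprod_hom_ext S C B (comp k (cp_pair C g h)));
    intros x; cbn [comp fn].
  - now rewrite !pair_in0.
  - now rewrite !pair_in1.
Qed.

Lemma comor_comul (S T : sgp) (CS : Coprod S) (bS : hom S (cp_obj CS))
  (CT : Coprod T) (bT : hom T (cp_obj CT)) (f : hom S T) :
  is_comor CS bS CT bT f ->
  forall (A : sgp) (g h : hom T A),
    heq (comp (comul CT bT g h) f) (comul CS bS (comp g f) (comp h f)).
Proof.
  intros Hf A g h s; specialize (Hf s); cbn [comp fn comul] in *; rewrite <- Hf.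
  apply (coprod_hom_ext S CS A (comp (cp_pair CT g h) (coprod_map CS CT f)));
    intros x; unfold coprod_map; cbn [comp fn].
  - now rewrite !pair_in0; cbn [comp fn]; rewrite pair_in0.
  - now rewrite !pair_in1; cbn [comp fn]; rewrite pair_in1.
Qed.

Lemma fn_rpow (A B : sgp) (k : hom A B) u w n : k (rpow u w n) = rpow (k u) (k w) n.
Proof.
  unfold rpow; induction n as [|n IH]; simpl; [reflexivity|].
  rewrite fn_op, IH; reflexivity.
Qed.

(** * Stutter-free words *)

(** [c] is the letter standing just before [t]. *)
Fixpoint col (c : nat) (t : list nat) : list nat :=
  match t with
  | [] => []
  | y :: t' => if y =? c then col c t' else y :: col y t'
  end.

Lemma col_same c t : col c (c :: t) = col c t.
Proof. simpl; now rewrite Nat.eqb_refl. Qed.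

Lemma col_neq c y t : y <> c -> col c (y :: t) = y :: col y t.
Proof. intros H; simpl; now rewrite (proj2 (Nat.eqb_neq y c) H). Qed.

Lemma col_col_app c a b : col c (col c a ++ b) = col c (a ++ b).
Proof.
  revert c; induction a as [|y a IH]; intros c; simpl; [reflexivity|].
  destruct (Nat.eqb_spec y c) as [->|H]; [apply IH|].
  simpl app; rewrite (col_neq c y _ H), IH; reflexivity.
Qed.

Lemma col_idem c a : col c (col c a) = col c a.
Proof. generalize (col_col_app c a []); now rewrite !app_nil_r. Qed.

Lemma col_app_col c a y b : col c (a ++ y :: col y b) = col c (a ++ y :: b).
Proof.
  revert c; induction a as [|z a IH]; intros c; simpl.
  - destruct (Nat.eqb_spec y c) as [->|H]; now rewrite col_idem.
  - destruct (z =? c); now rewrite IH.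
Qed.

Lemma col_map_col phi c a : col (phi c) (map phi (col c a)) = col (phi c) (map phi a).
Proof.
  revert c; induction a as [|y a IH]; intros c; simpl; [reflexivity|].
  destruct (Nat.eqb_spec y c) as [->|H].
  - now rewrite Nat.eqb_refl.
  - simpl; destruct (Nat.eqb_spec (phi y) (phi c)) as [<-|H']; now rewrite IH.
Qed.

Definition wop (u v : nat * list nat) : nat * list nat :=
  (fst u, col (fst u) (snd u ++ fst v :: snd v)).

Lemma wop_assoc u v w : wop (wop u v) w = wop u (wop v w).
Proof.
  destruct u as [x t], v as [y u], w as [z v]; unfold wop; simpl; f_equal.
  now rewrite col_col_app, col_app_col, <- app_assoc.
Qed.

(** Words in idempotent letters; the pair [(x, t)] stands for the word [x :: t], and every
    product is free of repeated adjacent letters. *)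
Definition W : sgp := Sgp (nat * list nat) wop wop_assoc.

Definition wmap (phi : nat -> nat) : hom W W.
Proof.
  refine (Hom W W (fun u : W => (phi (fst u), col (phi (fst u)) (map phi (snd u))) : W) _).
  intros [x t] [y u]; simpl; unfold wop; simpl; f_equal.
  now rewrite col_map_col, map_app, col_col_app, col_app_col.
Defined.

(** * Products of constant maps into [W] *)

Definition wcst (S : sgp) (i : nat) : hom S W.
Proof.
  refine (Hom S W (fun _ => (i, []) : W) _).
  intros _ _; simpl; unfold wop; simpl; now rewrite Nat.eqb_refl.
Defined.

Fixpoint wf (n x : nat) (t : list nat) : Prop :=
  x <= n /\ match t with [] => True | y :: t' => y <> x /\ wf n y t' end.

Lemma wf_le n x t : wf n x t -> x <= n.
Proof. destruct t; intros H; apply H. Qed.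

Lemma wf_col n x t : wf n x t -> col x t = t.
Proof.
  revert x; induction t as [|y t IH]; intros x H; [reflexivity|].
  destruct H as (_ & H & H'). rewrite (col_neq _ _ _ H), IH; auto.
Qed.

Lemma col_min_wf n x t : x <= n -> wf n x (col x (map (Nat.min n) t)).
Proof.
  revert x; induction t as [|y t IH]; intros x Hx; [simpl; auto|].
  simpl map. destruct (Nat.eq_dec (Nat.min n y) x) as [<-|H].
  - rewrite col_same; auto.
  - rewrite col_neq by auto. simpl; repeat split; auto. apply IH; lia.
Qed.

(** [tw T 0 (seq 1 n)] is the map [w_n]. *)
Fixpoint tw (T : Cosgp) (x : nat) (t : list nat) : hom (cs_car T) W :=
  match t with
  | [] => wcst _ x
  | y :: t' => comul (cs_cp T) (cs_beta T) (wcst _ x) (tw T y t')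
  end.

Lemma tw_app T x t y u :
  heq (comul (cs_cp T) (cs_beta T) (tw T x t) (tw T y u)) (tw T x (t ++ y :: u)).
Proof.
  revert x; induction t as [|z t IH]; intros x s; [reflexivity|].
  simpl tw. rewrite (cs_coassoc T). apply comul_ext; [intros ?; reflexivity|apply IH].
Qed.

Lemma wcst_idem T x :
  heq (comul (cs_cp T) (cs_beta T) (wcst _ x) (wcst _ x)) (wcst _ x).
Proof.
  intros s; simpl; symmetry.
  apply (cp_uniq _ (cs_cp T) W (wcst _ x) (wcst _ x) (wcst _ x)); intros ?; reflexivity.
Qed.

Lemma tw_col T x t : heq (tw T x t) (tw T x (col x t)).
Proof.
  revert x; induction t as [|y t IH]; intros x s; [reflexivity|].
  destruct (Nat.eq_dec y x) as [->|H].
  - rewrite col_same, <- IH. destruct t as [|z t]; simpl tw.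
    + apply wcst_idem.
    + rewrite <- (cs_coassoc T). apply comul_ext; [apply wcst_idem|intros ?; reflexivity].
  - rewrite (col_neq _ _ _ H). simpl tw. apply comul_ext; [intros ?; reflexivity|apply IH].
Qed.

Lemma wmap_tw T phi x t :
  heq (comp (wmap phi) (tw T x t)) (tw T (phi x) (col (phi x) (map phi t))).
Proof.
  intros s; rewrite <- tw_col.
  revert x s; induction t as [|y t IH]; intros x s; [reflexivity|].
  simpl tw. rewrite comp_comul. apply comul_ext; intros ?; [reflexivity|apply IH].
Qed.

(** Truncating letters by [Nat.min n] fixes the word [x :: t], hence the values of [tw T x t], and
    every value of that truncation is stutter-free. *)
Lemma tw_wf T n x t : wf n x t -> forall s, wf n (fst (tw T x t s)) (snd (tw T x t s)).
Proof.
  intros H s.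
  assert (E : wmap (Nat.min n) (tw T x t s) = tw T x t s).
  { generalize (wmap_tw T (Nat.min n) x t s); simpl.
    assert (M : forall y u, wf n y u -> Nat.min n y = y /\ map (Nat.min n) u = u).
    { intros y u; revert y; induction u as [|z u IH]; intros y [Hy Hu]; simpl.
      - split; [lia|auto].
      - destruct Hu as [_ Hu]; destruct (IH z Hu) as [-> ->]; split; [lia|auto]. }
    destruct (M x t H) as [-> ->]; rewrite (wf_col n x t H); auto. }
  rewrite <- E; simpl; apply col_min_wf; lia.
Qed.

(** For [a < b < n], the monotone surjection of [{0..n}] onto [{0,1,2}] that steps up just after [a]
    and just after [b]. *)
Definition thr (a b x : nat) : nat := Nat.b2n (a <? x) + Nat.b2n (b <? x).

Lemma thr_tw T a b n s : a < b -> b < n -> n <= 5 ->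
  wmap (thr a b) (tw T 0 (seq 1 n) s) = tw T 0 [1; 2] s.
Proof.
  intros Ha Hb Hn; generalize (wmap_tw T (thr a b) 0 (seq 1 n) s); simpl comp; intros E.
  etransitivity; [exact E|].
  (* Finitely many triples remain; in each one the collapse of the word [0 1 ... n] computes to
     [0 1 2]. *)
  do 6 (destruct n as [|n];
    [do 5 (destruct b as [|b];
      [do 5 (destruct a as [|a]; [first [lia|reflexivity]|]); lia|]); lia|]).
  lia.
Qed.

(** * Words over six letters are determined by their collapses to three letters *)

Lemma thr_sep x y : x <= 5 -> y <= 5 -> x <> y ->
  exists a b, a < b < 5 /\ thr a b x <> thr a b y.
Proof.
  (* Cut just after the smaller letter. The cap 3 keeps [a < b]; it acts only on the pair 4, 5,
     which the cut after 4 separates. *)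
  intros; exists (Nat.min 3 (Nat.min x y)), 4; unfold thr.
  repeat match goal with |- context [?u <? ?v] => destruct (Nat.ltb_spec u v) end;
    cbn [Nat.b2n Nat.add]; lia.
Qed.

Lemma thr_sep3 x y z : x <= 5 -> y <= 5 -> z <= 5 -> y <> x -> z <> x -> y <> z ->
  exists a b, a < b < 5 /\ thr a b y <> thr a b x /\ thr a b z <> thr a b x /\
    thr a b y <> thr a b z.
Proof.
  intros.
  assert (L : forall p q r, p < q < r -> r <= 5 -> exists a b, a < b < 5 /\
     thr a b p = 0 /\ thr a b q = 1 /\ thr a b r = 2).
  { intros p q r ? ?; exists p, q; unfold thr.
    repeat match goal with |- context [?u <? ?v] => destruct (Nat.ltb_spec u v) end; simpl; lia. }
  assert (D : x < y < z \/ x < z < y \/ y < x < z \/ y < z < x \/ z < x < y \/ z < y < x) by lia.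
  destruct D as [D|[D|[D|[D|[D|D]]]]]; destruct (L _ _ _ D) as (a & b & ? & ? & ? & ?);
    try lia; exists a, b; lia.
Qed.

(** Read both words in parallel. If their next letters [y], [y'] differed, some collapse would keep
    both apart from [x] and from each other, and so show the difference. *)
Lemma collapse_inj x t x' t' : wf 5 x t -> wf 5 x' t' ->
  (forall a b, a < b < 5 -> wmap (thr a b) (x, t) = wmap (thr a b) (x', t')) ->
  (x, t) = (x', t').
Proof.
  revert x x' t'; induction t as [|y t IH]; intros x x' t' H H' E.
  all: assert (x = x') as <- by
   (destruct (Nat.eq_dec x x') as [->|N]; [auto|]; destruct (thr_sep x x') as (a & b & Hab & F);
    [eapply wf_le, H|eapply wf_le, H'|auto|]; specialize (E a b Hab); simpl in E; congruence).
  - destruct t' as [|y' t']; [reflexivity|].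
    destruct (thr_sep y' x) as (a & b & Hab & F); [eapply wf_le, H'|apply H'|apply H'|].
    specialize (E a b Hab); cbn [wmap fn fst snd map] in E;
        rewrite col_neq in E by auto; discriminate.
  - destruct t' as [|y' t'].
    { destruct (thr_sep y x) as (a & b & Hab & F); [eapply wf_le, H|apply H|apply H|].
      specialize (E a b Hab); cbn [wmap fn fst snd map] in E;
        rewrite col_neq in E by auto; discriminate. }
    destruct H as (Hx & Hy & H), H' as (_ & Hy' & H').
    assert (y = y') as <-.
    { destruct (Nat.eq_dec y y') as [|N]; [auto|exfalso].
      destruct (thr_sep3 x y y') as (a & b & Hab & F1 & F2 & F3);
        [auto|eapply wf_le, H|eapply wf_le, H'|auto|auto|auto|].
      specialize (E a b Hab); cbn [wmap fn fst snd map] in E;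
        rewrite !col_neq in E by auto; congruence. }
    specialize (IH y y t' H H').
    assert ((y, t) = (y, t')) as [= <-]; [|reflexivity].
    apply IH; intros a b Hab; specialize (E a b Hab); cbn [wmap fn fst snd map] in *.
    apply (f_equal snd) in E; cbn [snd] in E; f_equal.
    (* Whether or not the collapse merges [y] with [x], it does so in both words, so the first
       letter can be stripped. *)
    destruct (Nat.eq_dec (thr a b y) (thr a b x)) as [Q|Q].
    + rewrite Q, !col_same in E; rewrite Q; auto.
    + rewrite !col_neq in E by auto; congruence.
Qed.

(** * Words all of whose collapses agree *)

Fixpoint rep (i a b : nat) : list nat :=
  match i with 0 => [] | S i' => a :: b :: rep i' a b end.

Lemma rep_S_r i a b u : rep i a b ++ a :: b :: u = rep (S i) a b ++ u.
Proof. induction i as [|i IH]; simpl in *; [reflexivity|]. now rewrite IH. Qed.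

Lemma rep_shift i a b u : rep i a b ++ a :: u = a :: rep i b a ++ u.
Proof. induction i as [|i IH]; simpl in *; [reflexivity|]. now rewrite IH. Qed.

Definition top (e : bool) : nat := if e then 2 else 0.
(** The block of [p_i] ([e = false]) or [q_i] ([e = true]) without its first letter [top e],
    regrouped as [(1 0)^i 1 2 (1 2)^i] or its reversal. *)
Definition run (e : bool) (i : nat) : list nat :=
  rep i 1 (top e) ++ 1 :: top (negb e) :: rep i 1 (top (negb e)).

(** [tail e l] omits the first letter [top e] of the word; [None] stands for a jump between [0]
    and [2], and [Some i] for a block of [p_i] or [q_i]. *)
Fixpoint tail (e : bool) (l : list (option nat)) : list nat :=
  match l with
  | [] => []
  | None :: l' => top (negb e) :: tail (negb e) l'
  | Some i :: l' => run e i ++ tail (negb e) l'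
  end.

(** Fuses [col] with the letter map and remembers the last source letter, so that it computes on a
    word of which only the first letters are known. *)
Fixpoint collapse (a b x : nat) (t : list nat) : list nat :=
  match t with
  | [] => []
  | y :: t' => if thr a b y =? thr a b x then collapse a b y t'
               else thr a b y :: collapse a b y t'
  end.

Lemma collapse_col a b x t : collapse a b x t = col (thr a b x) (map (thr a b) t).
Proof.
  revert x; induction t as [|y t IH]; intros x; simpl; [reflexivity|].
  destruct (Nat.eqb_spec (thr a b y) (thr a b x)) as [<-|_]; now rewrite IH.
Qed.

(** The three collapses of [{0..3}] to [{0..2}]; the flag [e] records the reversal of both
    alphabets, which fixes [mid] and exchanges the other two. *)
Definition lo (e : bool) := collapse (if e then 1 else 0) (if e then 2 else 1).
Definition mid := collapse 0 2.
Definition hi (e : bool) := collapse (if e then 0 else 1) (if e then 1 else 2).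
Definition lt4 (e : bool) (k : nat) := if e then 3 - k else k.

Ltac compute_letters :=
  cbn [lo mid hi lt4 top negb collapse thr Nat.eqb Nat.ltb Nat.leb Nat.b2n
    Nat.add Nat.sub rep app wf] in *.

(** Splits off the next letter and discards the cases where it is out of range, repeats its
    predecessor, or makes some collapse emit an unexpected letter. *)
Ltac next_letter t y :=
  destruct t as [|y t];
  [ compute_letters; try discriminate; try tauto
  | destruct y as [|[|[|[|y]]]]; compute_letters; try discriminate; try tauto;
    try (exfalso; repeat match goal with H : _ /\ _ |- _ => destruct H end;
         match goal with H : wf _ _ t |- _ => generalize (wf_le _ _ _ H); lia end) ].

(* The three parsing lemmas read a block of the four-letter word from left to right: for [e = false]
   it is [0 (1 0)^i 1 2 (1 2)^i 3 (2 3)^i], read in the order [parse_run], [parse_mid],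
   [parse_end].  The hypotheses on [lo], [mid] and [hi] give the part of the common collapse that
   each of them has still to produce; [hi] lags behind [mid], which lags behind [lo]. *)
Lemma parse_end e k t v :
  wf 3 (lt4 e 3) t ->
  lo e (lt4 e 3) t = v ->
  mid (lt4 e 3) t = rep k 1 (top (negb e)) ++ v ->
  hi e (lt4 e 3) t = rep k 1 (top (negb e)) ++ v ->
  exists t', length t' <= length t /\ wf 3 (lt4 e 3) t' /\
    lo e (lt4 e 3) t' = v /\ mid (lt4 e 3) t' = v /\ hi e (lt4 e 3) t' = v.
Proof.
  revert t; induction k as [|k IH]; intros t Hw HA HB HC.
  { exists t; auto. }
  destruct e; next_letter t y.
  all: next_letter t z.
  all: injection HB as HB; injection HC as HC;
    destruct (IH t) as (t' & Hl & H'); try tauto; exists t'; simpl; split; [lia|exact H'].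
Qed.

Lemma parse_mid e j k t v :
  wf 3 (lt4 e 2) t ->
  lo e (lt4 e 2) t = v ->
  mid (lt4 e 2) t = top (negb e) :: rep k 1 (top (negb e)) ++ v ->
  hi e (lt4 e 2) t = rep j (top e) 1 ++ top (negb e) :: rep k 1 (top (negb e)) ++ v ->
  exists t' v', length t' <= length t /\ wf 3 (lt4 e 3) t' /\
    lo e (lt4 e 3) t' = v' /\ mid (lt4 e 3) t' = v' /\ hi e (lt4 e 3) t' = v' /\
    v = rep j 1 (top (negb e)) ++ v'.
Proof.
  revert k t v; induction j as [|j IH]; intros k t v Hw HA HB HC.
  - destruct e; next_letter t y.
    all: injection HB as HB; injection HC as HC.
    1: destruct (parse_end true k t v) as (t' & Hl & H'); try tauto.
    2: destruct (parse_end false k t v) as (t' & Hl & H'); try tauto.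
    all: exists t', v; simpl; split; [lia|tauto].
  - destruct e; next_letter t y.
    all: next_letter t z.
    (* [lo] has produced one more round of [v], which [mid] and [hi] still owe, so [k] grows by
       one. *)
    all: subst v; injection HC as HC;
      rewrite rep_S_r in HB, HC;
      destruct (IH (S k) t _ ltac:(tauto) eq_refl HB HC) as (t' & v' & Hl & H1 & H2 & H3 & H4 & ->);
      exists t', v'; simpl; repeat split; auto; lia.
Qed.

Lemma parse_run e n i t u : length t <= n ->
  (1 <= i \/ exists t0, t = lt4 e 1 :: t0) ->
  wf 3 (lt4 e 0) t ->
  lo e (lt4 e 0) t = u ->
  mid (lt4 e 0) t = u ->
  hi e (lt4 e 0) t = rep i 1 (top e) ++ u ->
  exists j t' v', length t' < length t /\ wf 3 (lt4 e 3) t' /\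
    lo e (lt4 e 3) t' = v' /\ mid (lt4 e 3) t' = v' /\ hi e (lt4 e 3) t' = v' /\
    rep i 1 (top e) ++ u = run e j ++ v'.
Proof.
  revert i t u; induction n as [|n IH]; intros i t u Hn Hi Hw HA HB HC.
  { destruct t; [|simpl in Hn; lia].
    destruct Hi as [Hi|[t0 Hi]]; [destruct i; [lia|]|]; compute_letters; [subst u|]; discriminate. }
  destruct e; next_letter t y.
  (* For [i = 0] a jump between the end letters 0 and 3 agrees with all three collapses; [Hi]
     excludes it. *)
  all: try (destruct Hi as [Hi|[t0 Hi]]; [destruct i; [lia|]|]; compute_letters; congruence).
  all: next_letter t z.
  all: try (destruct i; subst u; compute_letters; discriminate).
  all: subst u.
  (* Here the word moves on to [lt4 e 2], which fixes the exponent as the number [i] of rounds that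
     [hi] owes. *)
  1, 4: rewrite rep_shift in HC; injection HC as HC; injection HB as HB.
  1: destruct (parse_mid true i 0 t _ ltac:(tauto) eq_refl HB HC)
    as (t' & v' & Hl & H1 & H2 & H3 & H4 & E).
  2: destruct (parse_mid false i 0 t _ ltac:(tauto) eq_refl HB HC)
    as (t' & v' & Hl & H1 & H2 & H3 & H4 & E).
  1, 2: exists i, t', v'; simpl; unfold run; rewrite <- app_assoc; simpl in E |- *; rewrite <- E;
    repeat split; auto; lia.
  (* Here the word returns to [lt4 e 0]: [lo] and [mid] have produced a round on which [hi] was
     silent. *)
  all: injection HB as HB; rewrite rep_S_r in HC; simpl in Hn;
    destruct (IH (S i) t _ ltac:(lia) ltac:(left; lia) ltac:(tauto) eq_refl HB HC)
      as (j & t' & v' & Hl & H1 & H2 & H3 & H4 & E);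
    exists j, t', v'; rewrite rep_S_r; simpl length; repeat split; auto; lia.
Qed.

(** The first letter decides: [lt4 e 1] opens a block, [lt4 e 3] is a jump, and at [lt4 e 2] the
    collapses [lo] and [mid] disagree. The rest starts at the opposite end, where [lo] and [hi]
    exchange roles. *)
Lemma parse e n t u : length t <= n ->
  wf 3 (lt4 e 0) t ->
  lo e (lt4 e 0) t = u -> mid (lt4 e 0) t = u -> hi e (lt4 e 0) t = u ->
  exists l, u = tail e l.
Proof.
  revert e t u; induction n as [|n IH]; intros e t u Hn Hw HA HB HC;
    destruct t as [|y t]; try (exists []; now rewrite <- HB); simpl in Hn.
  assert (Hrun : y = lt4 e 1 -> exists l, u = tail e l).
  { intros ->.
    destruct (parse_run e (S n) 0 (lt4 e 1 :: t) u) as (j & t' & v' & Hl & H1 & H2 & H3 & H4 & E);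
      try (simpl; lia); try (simpl rep; assumption); eauto.
    simpl in E, Hl.
    destruct (IH (negb e) t' v') as (l & ->); [lia|destruct e; assumption..|].
    exists (Some j :: l); exact E. }
  assert (Hcut : y = lt4 e 3 -> exists l, u = tail e l).
  { intros ->.
    assert (exists v, u = top (negb e) :: v) as [v ->] by
      (destruct e; compute_letters; eexists; symmetry; exact HA).
    destruct (IH (negb e) t v) as (l & ->);
      [lia|destruct e; compute_letters; unfold lo, hi in *; first [tauto|congruence]..|].
    exists (None :: l); reflexivity. }
  clear IH.
  destruct e; destruct y as [|[|[|[|y]]]]; compute_letters; auto; try tauto; try congruence;
    exfalso; destruct Hw as (_ & _ & Hw); generalize (wf_le _ _ _ Hw); lia.
Qed.

Lemma tw_parse (T : Cosgp) s : exists e l, tw T 0 [1; 2] s = (top e, tail e l).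
Proof.
  assert (E : forall a b, a < b < 3 ->
    wmap (thr a b) (tw T 0 [1; 2; 3] s) = tw T 0 [1; 2] s).
  { intros a b H; apply (thr_tw T a b 3); lia. }
  assert (Hw : wf 3 (fst (tw T 0 [1; 2; 3] s)) (snd (tw T 0 [1; 2; 3] s))).
  { apply tw_wf; simpl; lia. }
  destruct (tw T 0 [1; 2; 3] s) as [x t], (tw T 0 [1; 2] s) as [y u]; simpl fst in Hw; simpl snd in Hw.
  generalize (E 0 1 ltac:(lia)) (E 0 2 ltac:(lia)) (E 1 2 ltac:(lia)); cbn [wmap fn fst snd].
  rewrite <- !collapse_col; intros E1 E2 E3.
  generalize (wf_le _ _ _ Hw); intros Hx.
  (* A first letter 1 or 2 has different images under two of the collapses, so the word starts with
     0 or 3. *)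
  destruct x as [|[|[|[|x]]]]; try (cbn in E1, E2, E3; congruence); [| |lia].
  - destruct (parse false (length t) t u) as [l ->];
      [lia|exact Hw|exact (f_equal snd E1)|exact (f_equal snd E2)|exact (f_equal snd E3)|].
    exists false, l; f_equal; symmetry; exact (f_equal fst E1).
  - destruct (parse true (length t) t u) as [l ->];
      [lia|exact Hw|exact (f_equal snd E3)|exact (f_equal snd E2)|exact (f_equal snd E1)|].
    exists true, l; f_equal; symmetry; exact (f_equal fst E1).
Qed.

(** * Normal forms in R *)

Lemma top_neq1 e : top e <> 1.
Proof. now destruct e. Qed.

Lemma top_negb e : top (negb e) <> top e.
Proof. now destruct e. Qed.

Lemma col_rep i c u : c <> 1 -> col c (rep i 1 c ++ u) = rep i 1 c ++ col c u.
Proof.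
  intros H; induction i as [|i IH]; [reflexivity|]; simpl rep; simpl app.
  now rewrite col_neq, col_neq, IH by auto.
Qed.

Lemma col_run e i u : col (top e) (run e i ++ u) = run e i ++ col (top (negb e)) u.
Proof.
  unfold run; rewrite <- !app_assoc; simpl app.
  rewrite col_rep by apply top_neq1. rewrite col_neq by (generalize (top_neq1 e); auto).
  rewrite col_neq by apply top_neq1. now rewrite col_rep by apply top_neq1.
Qed.

Lemma col_tail e l : col (top e) (tail e l) = tail e l.
Proof.
  revert e; induction l as [|[i|] l IH]; intros e; simpl tail; [reflexivity| |].
  - now rewrite col_run, IH.
  - now rewrite col_neq, IH by apply top_negb.
Qed.

(** The exponent is the number of rounds before [top (negb e)] first occurs. *)
Lemma run_inj e i j u v : run e i ++ u = run e j ++ v -> i = j /\ u = v.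
Proof.
  assert (A : forall a b i j u v, a <> b ->
    rep i 1 a ++ 1 :: b :: u = rep j 1 a ++ 1 :: b :: v -> i = j /\ u = v).
  { clear; intros a b i; induction i as [|i IH]; intros [|j] u v H E; simpl in E.
    - injection E as ->; auto.
    - congruence.
    - congruence.
    - injection E as E; destruct (IH _ _ _ H E); auto. }
  unfold run; rewrite <- !app_assoc; simpl app; intros E.
  apply A in E; [|apply not_eq_sym, top_negb]; destruct E as [-> E].
  split; [reflexivity|]. now apply app_inv_head in E.
Qed.

Lemma run_head e i : exists r, run e i = 1 :: r.
Proof. destruct i; unfold run; simpl; eauto. Qed.

(** A block continues with 1 and a jump with [top (negb e)], so the list can be read off from the
    left. *)
Lemma tail_inj e l l' : tail e l = tail e l' -> l = l'.
Proof.
  revert e l'; induction l as [|[i|] l IH]; intros e [|[j|] l'] E; simpl in E; auto;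
    try (destruct (run_head e i) as [r Hr]; rewrite Hr in E);
    try (destruct (run_head e j) as [r' Hr']; rewrite Hr' in E);
    try discriminate; try (injection E; intros; destruct e; discriminate).
  - rewrite <- Hr, <- Hr' in E; apply run_inj in E as [-> E]; f_equal; eauto.
  - injection E as E; f_equal; eauto.
Qed.

(** [x] stands for [x00], [x11] and [y] for [p], [q]; lists are encoded as in [tail]. *)
Fixpoint nf {R : sgp} (x : bool -> R) (y : bool -> nat -> R) (e : bool) (l : list (option nat)) : R :=
  match l with
  | [] => x e
  | None :: l' => op (x e) (nf x y (negb e) l')
  | Some i :: l' => op (y e i) (nf x y (negb e) l')
  end.

Lemma nf_mul (R : sgp) (x : bool -> R) (y : bool -> nat -> R) :
  (forall e, op (x e) (x e) = x e) ->
  (forall e i, op (x e) (y e i) = y e i) ->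
  forall e l e' l', exists l'', op (nf x y e l) (nf x y e' l') = nf x y e l''.
Proof.
  intros Hx Hy e l e' l'; revert e; induction l as [|[i|] l IH]; intros e; simpl.
  (* At the junction an idempotent is absorbed by a form starting on its own side; otherwise the
     junction is a jump. *)
  - destruct (bool_dec e' e) as [->|N].
    + exists l'; destruct l' as [|[i|] l']; simpl; auto; rewrite <- op_assoc; congruence.
    + exists (None :: l'); simpl. replace (negb e) with e'; [reflexivity|].
      destruct e, e'; auto; congruence.
  - destruct (IH (negb e)) as [l'' E]; exists (Some i :: l''); now rewrite op_assoc, E.
  - destruct (IH (negb e)) as [l'' E]; exists (None :: l''); now rewrite op_assoc, E.
Qed.

Lemma nf_word (R : sgp) (x : bool -> R) (y : bool -> nat -> R) (k : hom R W) :
  (forall e, k (x e) = (top e, [])) ->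
  (forall e i, k (y e i) = (top e, run e i)) ->
  forall e l, k (nf x y e l) = (top e, tail e l).
Proof.
  intros Hx Hy e l; revert e; induction l as [|[i|] l IH]; intros e; simpl nf; auto;
    rewrite fn_op, IH, ?Hx, ?Hy; simpl op; unfold wop; simpl fst; simpl snd; simpl tail;
    f_equal; simpl app.
  - now rewrite col_run, col_same, col_tail.
  - now rewrite col_neq, col_tail by apply top_negb.
Qed.

Lemma rpow_word a b i : b <> a ->
  @rpow W (a, []) (b, [a]) i = (a, rep i b a).
Proof.
  intros H; induction i as [|i IH]; [reflexivity|].
  change (@rpow W (a, []) (b, [a]) (S i)) with (wop (@rpow W (a, []) (b, [a]) i) (b, [a])).
  rewrite IH; unfold wop; simpl fst; simpl snd; f_equal.
  rewrite rep_S_r, app_nil_r; clear IH.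
  induction (S i) as [|n IH]; [reflexivity|]; simpl rep; now rewrite !col_neq, IH by auto.
Qed.

(** The shape in which the co-operation yields [w_2] at [p_i] and [q_i]; for [p_i] the regrouping is
    [1 (2 1)^i 2 = 1 2 (1 2)^i]. *)
Lemma run_word e i :
  wop (wop (top e, rep i 1 (top e)) (1, rep i (top (negb e)) 1)) (top (negb e), []) = (top e, run e i).
Proof.
  unfold wop; simpl fst; simpl snd; f_equal.
  rewrite col_col_app, <- app_assoc; simpl app.
  rewrite (rep_shift i (top (negb e)) 1 []), (app_nil_r (rep i 1 _)).
  generalize (col_run e i []); unfold run; now rewrite !app_nil_r.
Qed.

(** * The presented semigroup [R] and coassociativity of its co-operation *)

Section Presentation.
Context (R : sgp) (x00 x11 : R) (p q : nat -> R) (HR : is_R_presentation R x00 x11 p q).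

Lemma pres_hom_ext (A : sgp) (g h : hom R A) :
  g x00 = h x00 -> g x11 = h x11 -> (forall i, g (p i) = h (p i)) ->
  (forall i, g (q i) = h (q i)) -> heq g h.
Proof.
  intros E0 E1 Ep Eq; destruct HR as [(H0 & H1 & Hp & Hq) HU].
  destruct (HU A (h x00) (h x11) (fun i => h (p i)) (fun i => h (q i))) as (f & _ & Hf).
  - repeat split; rewrite <- fn_op; f_equal; auto; try apply Hp; apply Hq.
  - intros r; rewrite (Hf g), (Hf h); auto.
Qed.

Lemma pres_ind (P : R -> Prop) :
  (forall x y, P x -> P y -> P (op x y)) ->
  P x00 -> P x11 -> (forall i, P (p i)) -> (forall i, P (q i)) -> forall r, P r.
Proof.
  intros HP P0 P1 Pp Pq r; destruct HR as [(H0 & H1 & Hp & Hq) HU].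
  destruct (HU (sub_sgp R P HP) (exist P x00 P0) (exist P x11 P1)
    (fun i => exist P (p i) (Pp i)) (fun i => exist P (q i) (Pq i))) as (f & (F0 & F1 & Fp & Fq) & _).
  - repeat split; apply subset_eq_compat; simpl; auto; try apply Hp; apply Hq.
  - assert (E : heq (comp (sub_incl R P HP) f) (cid R)).
    { apply pres_hom_ext; intros; cbn [comp fn sub_incl cid].
      - now rewrite F0.
      - now rewrite F1.
      - now rewrite Fp.
      - now rewrite Fq. }
    specialize (E r); simpl in E; rewrite <- E; apply proj2_sig.
Qed.

Let x (e : bool) : R := if e then x11 else x00.
Let y (e : bool) : nat -> R := if e then q else p.

Lemma pres_nf r : exists e l, r = nf x y e l.
Proof.
  destruct HR as [(H0 & H1 & Hp & Hq) _]; revert r; apply pres_ind.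
  - intros r r' (e & l & ->) (e' & l' & ->).
    destruct (nf_mul R x y) with (e := e) (l := l) (e' := e') (l' := l') as [l'' ->]; eauto.
    + intros []; assumption.
    + intros [] i; [apply Hq|apply Hp].
  - exists false, []; reflexivity.
  - exists true, []; reflexivity.
  - intros i; exists false, [Some i]; symmetry; apply Hp.
  - intros i; exists true, [Some i]; symmetry; apply Hq.
Qed.

Lemma pres_word_inj (k : hom R W) :
  k x00 = (0, []) -> k x11 = (2, []) ->
  (forall i, k (p i) = (0, run false i)) -> (forall i, k (q i) = (2, run true i)) ->
  forall r r', k r = k r' -> r = r'.
Proof.
  intros K0 K1 Kp Kq r r'; destruct (pres_nf r) as (e & l & ->), (pres_nf r') as (e' & l' & ->).
  assert (K : forall e l, k (nf x y e l) = (top e, tail e l)).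
  { apply nf_word; [intros []|intros [] i]; simpl; auto. }
  rewrite !K; intros E.
  assert (e = e') as <- by (destruct e, e'; simpl in E; congruence).
  apply (f_equal snd), tail_inj in E; congruence.
Qed.

Lemma pres_word_surj (k : hom R W) :
  k x00 = (0, []) -> k x11 = (2, []) ->
  (forall i, k (p i) = (0, run false i)) -> (forall i, k (q i) = (2, run true i)) ->
  forall e l, exists r, k r = (top e, tail e l).
Proof.
  intros K0 K1 Kp Kq e l; exists (nf x y e l).
  apply nf_word; [intros []|intros [] i]; simpl; auto.
Qed.

Context (C : Coprod R) (beta : hom R (cp_obj C)).
Context (B0 : beta x00 = cp_in0 C x00) (B1 : beta x11 = cp_in1 C x11).
Context (Bp : forall i, beta (p i) =
   op (rpow (cp_in0 C (p i)) (op (cp_in1 C x00) (cp_in0 C x11)) i) (cp_in1 C (p i))).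
Context (Bq : forall i, beta (q i) =
   op (rpow (cp_in1 C (q i)) (op (cp_in0 C x11) (cp_in1 C x00)) i) (cp_in0 C (q i))).

Lemma comul_x00 (A : sgp) (g h : hom R A) : comul C beta g h x00 = g x00.
Proof. cbn [comul comp fn]; now rewrite B0, pair_in0. Qed.

Lemma comul_x11 (A : sgp) (g h : hom R A) : comul C beta g h x11 = h x11.
Proof. cbn [comul comp fn]; now rewrite B1, pair_in1. Qed.

Lemma comul_p (A : sgp) (g h : hom R A) i :
  comul C beta g h (p i) = op (rpow (g (p i)) (op (h x00) (g x11)) i) (h (p i)).
Proof. cbn [comul comp fn]; now rewrite Bp, fn_op, fn_rpow, fn_op, !pair_in0, !pair_in1. Qed.

Lemma comul_q (A : sgp) (g h : hom R A) i :
  comul C beta g h (q i) = op (rpow (h (q i)) (op (g x11) (h x00)) i) (g (q i)).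
Proof. cbn [comul comp fn]; now rewrite Bq, fn_op, fn_rpow, fn_op, !pair_in0, !pair_in1. Qed.

Lemma op_rpow (A : sgp) (u v w : A) i : op u (rpow v w i) = rpow (op u v) w i.
Proof.
  unfold rpow; induction i as [|i IH]; simpl; [reflexivity|]. now rewrite <- op_assoc, IH.
Qed.

(** It suffices to compare generators. At [p i] both bracketings give [g(p_i) (h(x00) g(x11))^i
    h(p_i) (k(x00) h(x11))^i k(p_i)]; [q i] is dual. *)
Lemma R_coassoc : coassoc C beta.
Proof.
  intros A g h k; apply pres_hom_ext; intros;
    rewrite ?comul_x00, ?comul_x11, ?comul_p, ?comul_q, ?comul_x00, ?comul_x11, <- ?op_rpow, ?op_assoc;
    reflexivity.
Qed.
End Presentation.

(** * Words over a coproduct *)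

Section CoprodWords.
Context (S : sgp) (C : Coprod S) (k : hom S W).
Context (Hwf : forall s, wf 2 (fst (k s)) (snd (k s))) (Hinj : forall s s', k s = k s' -> s = s').

Definition coproj (e : bool) : hom S (cp_obj C) := if e then cp_in1 C else cp_in0 C.

(** Factors alternate between the two copies of [S], so the copy of the first one suffices. *)
Fixpoint alt (e : bool) (s : S) (l : list S) : cp_obj C :=
  match l with
  | [] => coproj e s
  | s' :: l' => op (coproj e s) (alt (negb e) s' l')
  end.

Lemma alt_mul e s l e' s' l' : exists s'' l'', op (alt e s l) (alt e' s' l') = alt e s'' l''.
Proof.
  revert e s; induction l as [|s1 l IH]; intros e s; simpl.
  - destruct (bool_dec e' e) as [->|N].
    + exists (op s s'), l'; destruct l'; simpl; rewrite fn_op, ?op_assoc; reflexivity.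
    + exists s, (s' :: l'); simpl. replace (negb e) with e'; [reflexivity|].
      destruct e, e'; auto; congruence.
  - destruct (IH (negb e) s1) as (s2 & l2 & E); exists s, (s2 :: l2); simpl.
    now rewrite op_assoc, E.
Qed.

Lemma alt_surj u : exists e s l, u = alt e s l.
Proof.
  revert u; apply coprod_ind.
  - intros u v (e & s & l & ->) (e' & s' & l' & ->).
    destruct (alt_mul e s l e' s' l') as (s2 & l2 & ->); eauto.
  - intros s; exists false, s, []; reflexivity.
  - intros s; exists true, s, []; reflexivity.
Qed.

(** The two copies are written in the disjoint alphabets [{0,1,2}] and [{3,4,5}]. *)
Definition double : hom (cp_obj C) W := cp_pair C k (comp (wmap (Nat.add 3)) k).

Definition sh (e : bool) (x : nat) : nat := if e then 3 + x else x.
Definition side (x : nat) : bool := 3 <=? x.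

Lemma side_sh e x : x <= 2 -> side (sh e x) = e.
Proof. intros H; destruct e; [reflexivity|]; apply Nat.leb_gt; simpl; lia. Qed.

Lemma sh_inj e x y : sh e x = sh e y -> x = y.
Proof. destruct e; simpl; lia. Qed.

Lemma col_sh e x t : wf 2 x t -> col (sh e x) (map (sh e) t) = map (sh e) t.
Proof.
  revert x; induction t as [|z t IH]; intros x H; [reflexivity|]; simpl map.
  destruct H as (_ & H & H'); rewrite col_neq, IH; auto.
  intros E; apply sh_inj in E; auto.
Qed.

Lemma col_sh_app e x t y u : wf 2 x t -> side y = negb e -> col y u = u ->
  col (sh e x) (map (sh e) t ++ y :: u) = map (sh e) t ++ y :: u.
Proof.
  intros H Hy Hu; revert x H; induction t as [|z t IH]; intros x H; simpl map; simpl app.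
  - rewrite col_neq, Hu; auto. intros ->.
    rewrite side_sh in Hy by (eapply wf_le, H). now destruct e.
  - destruct H as (_ & H & H'); rewrite col_neq, IH; auto.
    intros E; apply sh_inj in E; auto.
Qed.

Lemma double_coproj e s :
  double (coproj e s) = (sh e (fst (k s)), map (sh e) (snd (k s))).
Proof.
  unfold double, coproj; destruct e.
  - rewrite pair_in1; cbn [comp fn wmap]. f_equal. apply (col_sh true), Hwf.
  - rewrite pair_in0. destruct (k s) as [a t]; simpl. f_equal; symmetry; apply map_id.
Qed.

Fixpoint flat (e : bool) (s : S) (l : list S) : list nat :=
  sh e (fst (k s)) :: map (sh e) (snd (k s)) ++
  match l with [] => [] | s' :: l' => flat (negb e) s' l' end.

(** Neighbouring factors use disjoint alphabets, so nothing is absorbed between them. The last two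
    clauses carry the induction. *)
Lemma double_alt e s l :
  fst (double (alt e s l)) :: snd (double (alt e s l)) = flat e s l /\
  side (fst (double (alt e s l))) = e /\
  col (fst (double (alt e s l))) (snd (double (alt e s l))) = snd (double (alt e s l)).
Proof.
  revert e s; induction l as [|s' l IH]; intros e s; simpl alt; simpl flat.
  - rewrite double_coproj; simpl; rewrite app_nil_r; split; [reflexivity|split].
    + apply side_sh; eapply wf_le, Hwf.
    + apply col_sh, Hwf.
  - destruct (IH (negb e) s') as (E & Hs & Hc).
    rewrite fn_op, double_coproj; cbn [op W wop fst snd]; unfold wop; cbn [fst snd].
    rewrite col_idem, col_sh_app, E by auto. split; [reflexivity|split; [|reflexivity]].
    apply side_sh; eapply wf_le, Hwf.
Qed.

Lemma split_side e a a' r r' :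
  Forall (fun x => side x = e) a -> Forall (fun x => side x = e) a' ->
  (forall x r0, r = x :: r0 -> side x = negb e) ->
  (forall x r0, r' = x :: r0 -> side x = negb e) ->
  a ++ r = a' ++ r' -> a = a' /\ r = r'.
Proof.
  intros Ha; revert a'; induction Ha as [|x a Hx Ha IH]; intros a' Ha' Hr Hr' E;
    destruct Ha' as [|x' a' Hx' Ha']; simpl in E; auto.
  - specialize (Hr _ _ E); destruct e; simpl in *; congruence.
  - specialize (Hr' _ _ (eq_sym E)); destruct e; simpl in *; congruence.
  - injection E as -> E; destruct (IH a' Ha' Hr Hr' E) as [-> ->]; auto.
Qed.

Lemma flat_head e s l x r : flat e s l = x :: r -> side x = e.
Proof.
  destruct l; simpl; intros [= <- _]; apply side_sh; eapply wf_le, Hwf.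
Qed.

Lemma side_block e s : Forall (fun x => side x = e) (sh e (fst (k s)) :: map (sh e) (snd (k s))).
Proof.
  generalize (Hwf s); generalize (fst (k s)); induction (snd (k s)) as [|z t IH]; intros x H; simpl;
    constructor; auto.
  - apply side_sh, H.
  - apply side_sh; eapply wf_le, H.
  - apply IH, H.
Qed.

(** Cutting where the alphabet changes recovers the blocks, and each block determines its factor by
    injectivity of [k]. *)
Lemma flat_inj l e s e' s' l' : flat e s l = flat e' s' l' -> alt e s l = alt e' s' l'.
Proof.
  revert e s e' s' l'; induction l as [|s1 l IH]; intros e s e' s' l' E;
    assert (e = e') as <- by
      (destruct (flat e' s' l') as [|z r] eqn:E'; [destruct l'; discriminate|];
       apply flat_head in E, E'; congruence);
    destruct l' as [|s1' l']; cbn [flat] in E;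
    rewrite !app_comm_cons in E; apply (split_side e) in E; try apply side_block;
    try discriminate; try (intros z r Ez; apply flat_head in Ez; exact Ez);
    destruct E as [E Er].
  2: destruct l'; discriminate.
  2: destruct l; discriminate.
  all: assert (s = s') as <- by
    (apply Hinj; rewrite (surjective_pairing (k s)), (surjective_pairing (k s'));
     injection E as E1 E2; apply sh_inj in E1; f_equal; auto;
     revert E2; generalize (snd (k s)) (snd (k s')); clear;
     intros t; induction t as [|z t IH]; intros [|z' t'] [=]; auto;
     f_equal; auto; eapply sh_inj; eauto).
  - reflexivity.
  - simpl; f_equal; auto.
Qed.

Lemma double_inj u v : double u = double v -> u = v.
Proof.
  destruct (alt_surj u) as (e & s & l & ->), (alt_surj v) as (e' & s' & l' & ->); intros E.
  apply flat_inj.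
  destruct (double_alt e s l) as [<- _], (double_alt e' s' l') as [<- _]. now rewrite E.
Qed.
End CoprodWords.

(** * The unique morphism to [R] *)

Lemma tw_double T :
  heq (comul (cs_cp T) (cs_beta T) (tw T 0 [1; 2]) (comp (wmap (Nat.add 3)) (tw T 0 [1; 2])))
      (tw T 0 (seq 1 5)).
Proof.
  intros s; etransitivity; [|apply (tw_app T 0 [1; 2] 3 [4; 5])].
  apply comul_ext; [intros ?; reflexivity|apply wmap_tw].
Qed.

Lemma tw_comor (S T : Cosgp) (f : hom (cs_car S) (cs_car T)) :
  is_comor (cs_cp S) (cs_beta S) (cs_cp T) (cs_beta T) f ->
  forall x t, heq (comp (tw T x t) f) (tw S x t).
Proof.
  intros Hf x t; revert x; induction t as [|y t IH]; intros x s; [reflexivity|].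
  simpl tw. rewrite (comor_comul _ _ _ _ _ _ f Hf).
  apply comul_ext; [intros ?; reflexivity|apply IH].
Qed.

Lemma tw_six_eq (S T : Cosgp) s t : tw S 0 [1; 2] s = tw T 0 [1; 2] t ->
  tw S 0 (seq 1 5) s = tw T 0 (seq 1 5) t.
Proof.
  intros E; rewrite (surjective_pairing (tw S _ _ s)), (surjective_pairing (tw T _ _ t)).
  apply collapse_inj; try (apply tw_wf; simpl; lia).
  intros a b H; rewrite <- !surjective_pairing, !thr_tw by lia; exact E.
Qed.

Theorem theorem11p6 :
  forall (R : sgp) (x00 x11 : R) (p q : nat -> R),
    is_R_presentation R x00 x11 p q ->
    forall (C : Coprod R) (beta : hom R (cp_obj C)),
      beta x00 = cp_in0 C x00 ->
      beta x11 = cp_in1 C x11 ->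
      (forall i, beta (p i) =
         op (rpow (cp_in0 C (p i)) (op (cp_in1 C x00) (cp_in0 C x11)) i)
            (cp_in1 C (p i))) ->
      (forall i, beta (q i) =
         op (rpow (cp_in1 C (q i)) (op (cp_in0 C x11) (cp_in1 C x00)) i)
            (cp_in0 C (q i))) ->
      coassoc C beta /\
      forall T : Cosgp,
        exists f : hom (cs_car T) R,
          is_comor (cs_cp T) (cs_beta T) C beta f /\
          forall g : hom (cs_car T) R,
            is_comor (cs_cp T) (cs_beta T) C beta g -> heq g f.
Proof.
  intros R x00 x11 p q HR C beta B0 B1 Bp Bq.
  pose proof (R_coassoc R x00 x11 p q HR C beta B0 B1 Bp Bq) as Hco.
  split; [exact Hco|]. intros T.
  pose (RC := Build_Cosgp R C beta Hco).
  pose (k := tw RC 0 [1; 2] : hom R W).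
  assert (K0 : k x00 = (0, [])).
  { apply (comul_x00 R x00 C beta B0). }
  assert (K1 : k x11 = (2, [])).
  { etransitivity; [apply (comul_x11 R x11 C beta B1)|apply (comul_x11 R x11 C beta B1)]. }
  assert (Kp : forall i, k (p i) = (0, run false i)).
  { intros i; unfold k; simpl tw.
    rewrite (comul_p R x00 x11 p C beta Bp), (comul_p R x00 x11 p C beta Bp).
    rewrite (comul_x00 R x00 C beta B0). cbn [fn wcst].
    rewrite (rpow_word 0 1), (rpow_word 1 2) by discriminate.
    rewrite <- op_assoc; apply (run_word false). }
  assert (Kq : forall i, k (q i) = (2, run true i)).
  { intros i; unfold k; simpl tw.
    rewrite (comul_q R x00 x11 q C beta Bq), (comul_q R x00 x11 q C beta Bq).
    rewrite (comul_x00 R x00 C beta B0). cbn [fn wcst].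
    rewrite <- op_rpow, (rpow_word 1 0), (rpow_word 2 1) by discriminate.
    apply (run_word true). }
  pose proof (pres_word_inj R x00 x11 p q HR k K0 K1 Kp Kq) as Hinj.
  (* Every value of [w_2] on [T] parses into jumps and blocks, hence is the word of a normal form in
     [R]. *)
  assert (Hex : forall s, {r | k r = tw T 0 [1; 2] s}).
  { intros s; apply constructive_indefinite_description.
    destruct (tw_parse T s) as (e & l & ->).
    apply (pres_word_surj R x00 x11 p q k K0 K1 Kp Kq). }
  assert (Hop : forall s t, proj1_sig (Hex (op s t)) = op (proj1_sig (Hex s)) (proj1_sig (Hex t))).
  { intros s t; apply Hinj. now rewrite fn_op, !(proj2_sig (Hex _)), fn_op. }
  pose (f := Hom (cs_car T) R (fun s => proj1_sig (Hex s)) Hop).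
  assert (Hf : forall s, k (f s) = tw T 0 [1; 2] s) by (intros s; apply (proj2_sig (Hex s))).
  exists f; split.
  (* After the injective map [double], both sides of the morphism equation become [w_5(s)]. *)
  - intros s; apply (double_inj R C k); [apply (tw_wf RC); simpl; lia|exact Hinj|].
    cbn [comp fn].
    transitivity (tw T 0 (seq 1 5) s).
    + rewrite <- tw_double.
      apply (coprod_hom_ext _ _ _ (comp (double R C k) (coprod_map (cs_cp T) C f)));
        intros z; unfold double, coprod_map; cbn [comp fn].
      * now rewrite !pair_in0; cbn [comp fn]; rewrite pair_in0, Hf.
      * now rewrite !pair_in1; cbn [comp fn]; rewrite pair_in1; cbn [comp fn]; rewrite Hf.
    + rewrite (tw_six_eq T RC s (f s)) by (symmetry; apply Hf).
      symmetry; apply (tw_double RC (f s)).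
  - intros g Hg s; apply Hinj; rewrite Hf; apply (tw_comor T RC g Hg 0 [1; 2] s).
Qed.
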